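(* Let $I\subset S$ be a proper monomial ideal with no embedded prime ideals. If the polarization $I^p$ is $k$-clean (in the polynomial ring $S^p$), then $I$ is $k$-clean.
   Context: $S=K[x_1,\dots,x_n]$ is a polynomial ring over a field $K$. For a monomial $u=x_1^{a_1}\cdots x_n^{a_n}$, $\mathrm{supp}(u)=\{i: a_i>0\}$. The polarization of a monomial $u=x_{i_1}^{a_1}\cdots x_{i_t}^{a_t}$ (distinct $i_j$) is $u^p=\prod_{j=1}^t x_{i_j1}x_{i_j2}\cdots x_{i_ja_j}$, a squarefree monomial in a polynomial ring $S^p=K[x_{ij}:1\le i\le n,\,1\le j\le N]$ with $N$ large enough; the polarization of a monomial ideal $I$ with minimal monomial generating set $G(I)$ is $I^p=(u^p: u\in G(I))\subset S^p$. For an ideal $I$, $\min(I)$ denotes the set of minimal prime ideals of $I$. A monomial $u\neq 1$ with $u\notin I$ is a cleaner monomial of the monomial ideal $I$ if $\min(I+Su)\subseteq \min(I)$. For an integer $k\ge 0$, the class of $k$-clean monomial ideals (in any polynomial ring) is defined recursively (as the smallest class closed under the following rule): a proper monomial ideal $I$ is $k$-clean if either $I$ is a prime ideal, or $I$ has no embedded prime ideals (i.e. $\mathrm{Ass}(S/I)=\min(I)$) and there exists a cleaner monomial $u$ of $I$ with $|\mathrm{supp}(u)|\le k+1$ such that both $I:u$ and $I+Su$ are $k$-clean. *)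

(* Defs.v *)
From HB Require Import structures.
From mathcomp Require Import all_boot all_order all_algebra.
Set Implicit Arguments. Unset Strict Implicit. Unset Printing Implicit Defensive.
Import GRing.Theory.
Local Open Scope ring_scope.

Fixpoint MP (K : fieldType) (n : nat) : idomainType :=
  match n with
  | 0 => K
  | m.+1 => ({poly MP K m} : idomainType)
  end.

Fixpoint varn (K : fieldType) (n i : nat) : MP K n :=
  match n return MP K n with
  | 0 => 0
  | m.+1 => if i == m then ('X : {poly MP K m}) else (varn K m i)%:P
  end.

Section Ideals.
Variable R : comNzRingType.

Definition isIdeal (I : R -> Prop) : Prop :=
  I 0 /\ (forall a b, I a -> I b -> I (a + b)) /\ (forall r a, I a -> I (r * a)).

Definition idealGen (G : R -> Prop) : R -> Prop :=
  fun f => exists s : seq (R * R),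
    (forall p, p \in s -> G p.2) /\ f = \sum_(p <- s) p.1 * p.2.

Definition properIdeal (I : R -> Prop) : Prop := isIdeal I /\ ~ I 1.

Definition primeIdeal (P : R -> Prop) : Prop :=
  properIdeal P /\ forall a b, P (a * b) -> P a \/ P b.

Definition subideal (I J : R -> Prop) : Prop := forall f, I f -> J f.

Definition minprime (I P : R -> Prop) : Prop :=
  primeIdeal P /\ subideal I P /\
  forall Q, primeIdeal Q -> subideal I Q -> subideal Q P -> subideal P Q.

Definition colon (I : R -> Prop) (f : R) : R -> Prop := fun g => I (g * f).

Definition add_principal (I : R -> Prop) (f : R) : R -> Prop :=
  fun g => exists a r, I a /\ g = a + r * f.

Definition assprime (I P : R -> Prop) : Prop :=
  primeIdeal P /\ exists f, forall g, P g <-> colon I f g.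

Definition no_embedded (I : R -> Prop) : Prop :=
  forall P, assprime I P <-> minprime I P.

End Ideals.

Section Monomials.
Variable K : fieldType.

Definition mono (n : nat) (a : nat -> nat) : MP K n :=
  \prod_(i < n) varn K n i ^+ a i.

Definition is_monomial (n : nat) (u : MP K n) : Prop := exists a, u = mono n a.

Definition monomial_ideal (n : nat) (I : MP K n -> Prop) : Prop :=
  isIdeal I /\
  forall f, I f <-> idealGen (fun g => I g /\ is_monomial g) f.

Definition min_gen (n : nat) (I : MP K n -> Prop) (u : MP K n) : Prop :=
  is_monomial u /\ I u /\
  forall v, is_monomial v -> I v -> (exists w, u = v * w) -> v = u.

Definition cleaner (n : nat) (I : MP K n -> Prop) (u : MP K n) : Prop :=
  u != 1 /\ is_monomial u /\ ~ I u /\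
  forall P, minprime (add_principal I u) P -> minprime I P.

Definition supp_le (n : nat) (u : MP K n) (b : nat) : Prop :=
  exists a, u = mono n a /\ (#|[set i : 'I_n | 0 < a i]| <= b)%N.

Inductive kclean (k : nat) : forall n : nat, (MP K n -> Prop) -> Prop :=
| kclean_prime n (I : MP K n -> Prop) :
    monomial_ideal I -> properIdeal I -> primeIdeal I -> kclean k I
| kclean_step n (I : MP K n -> Prop) (u : MP K n) :
    monomial_ideal I -> properIdeal I -> no_embedded I ->
    cleaner I u -> supp_le u k.+1 ->
    kclean k (colon I u) -> kclean k (add_principal I u) -> kclean k I.

(* Polarization. S^p = K[x_{ij} : i < n, j < N], with x_{ij} encoded as the
   variable number i*N + j of S_{n*N}. *)
Definition polvar (n N i j : nat) : MP K (n * N) := varn K (n * N) (i * N + j).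

Definition polar_mono (n N : nat) (a : nat -> nat) : MP K (n * N) :=
  \prod_(i < n) \prod_(j < a i) polvar n N i j.

Definition polar_bound (n N : nat) (I : MP K n -> Prop) : Prop :=
  forall a, min_gen I (mono n a) -> forall i, (i < n)%N -> (a i <= N)%N.

Definition polarization (n N : nat) (I : MP K n -> Prop) : MP K (n * N) -> Prop :=
  idealGen (fun g => exists a, min_gen I (mono n a) /\ g = polar_mono n N a).

End Monomials.
Arguments polarization [K n] N I.
Arguments polar_mono [K] n N a.
Arguments polvar [K] n N i j.

(* Main.v *)
(* Let [pi : S^p -> S] be the depolarization [x_ij |-> x_i] and [Y] its kernel.
   The property [J /\ Y = J Y] (that is, [Tor_1(S^p/J, S^p/Y) = 0]) passes from
   [J : u] and [J + (u)] to [J], and if [J + (u)] has it then [pi (J : u) = pi J : pi u].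
   So by induction along a k-clean decomposition of [J] the images form a k-clean
   decomposition of [pi J], provided every minimal prime [P] of [J] has the property
   and is mapped onto a minimal prime of [pi J]; this condition is inherited by
   [J : u] and [J + (u)], whose minimal primes are minimal primes of [J].
   For [J = I^p], a minimal prime [P] is generated by at most one variable from each
   fiber [x_i1, x_i2, ...], which gives the property for [P], and [pi P] is the
   annihilator modulo [I] of a maximal standard monomial; since [I] has no embedded
   primes, [pi P] is minimal over [I]. *)
From Stdlib Require Import Classical ClassicalEpsilon.
From Stdlib Require Import FunctionalExtensionality PropExtensionality.
Require Import Defs.
From mathcomp Require Import all_boot all_order all_algebra.
Set Implicit Arguments. Unset Strict Implicit. Unset Printing Implicit Defensive.
Import GRing.Theory.
Local Open Scope ring_scope.

Lemma pred_ext (T : Type) (I J : T -> Prop) : (forall f, I f <-> J f) -> I = J.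
Proof.
by move=> IJ; apply: functional_extensionality => f; apply: propositional_extensionality.
Qed.

(** * Associated and minimal primes under colon and sum *)

Section IdealTheory.
Variable R : comNzRingType.
Implicit Types (I J P Q : R -> Prop) (f g u v : R).

Lemma isIdeal0 I : isIdeal I -> I 0. Proof. by case. Qed.

Lemma isIdealD I f g : isIdeal I -> I f -> I g -> I (f + g).
Proof. by case=> _ [+ _]; apply. Qed.

Lemma isIdealMl I f g : isIdeal I -> I g -> I (f * g).
Proof. by case=> _ [_]; apply. Qed.

Lemma isIdealMr I f g : isIdeal I -> I f -> I (f * g).
Proof. by rewrite mulrC; apply: isIdealMl. Qed.

Lemma isIdealB I f g : isIdeal I -> I f -> I g -> I (f - g).
Proof. by move=> idI If Ig; rewrite -mulN1r; apply: isIdealD => //; apply: isIdealMl. Qed.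

Lemma ideal_sum I (X : Type) (s : seq X) (p : pred X) (F : X -> R) :
  isIdeal I -> (forall x, p x -> I (F x)) -> I (\sum_(x <- s | p x) F x).
Proof.
by move=> idI IF; apply: big_ind => //; [exact: isIdeal0 | move=> f g; exact: isIdealD].
Qed.

Lemma idealGen_ideal (G : R -> Prop) : isIdeal (idealGen G).
Proof.
split; first by exists [::]; split => //; rewrite big_nil.
split=> [a b [s [Gs ->]] [t [Gt ->]] | r a [s [Gs ->]]].
  exists (s ++ t); split=> [p|]; last by rewrite big_cat.
  by rewrite mem_cat => /orP[/Gs|/Gt].
exists [seq (r * p.1, p.2) | p <- s]; split=> [p /mapP[q /Gs Gq ->] //|].
by rewrite big_map mulr_sumr; apply: eq_bigr => p _; rewrite mulrA.
Qed.

Lemma idealGen_gen (G : R -> Prop) f : G f -> idealGen G f.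
Proof.
move=> Gf; exists [:: (1, f)]; split=> [p|]; first by rewrite inE => /eqP->.
by rewrite big_seq1 mul1r.
Qed.

Lemma idealGen_min (G : R -> Prop) I :
  isIdeal I -> (forall f, G f -> I f) -> subideal (idealGen G) I.
Proof.
move=> idI GI f [s [Gs ->]]; rewrite big_seq; apply: ideal_sum => // p /Gs Gp.
by apply: isIdealMl => //; apply: GI.
Qed.

Lemma colon_ideal I f : isIdeal I -> isIdeal (colon I f).
Proof.
move=> idI; split; first by rewrite /colon mul0r; apply: isIdeal0.
split=> [a b|r a]; first by rewrite /colon mulrDl; apply: isIdealD.
by rewrite /colon -mulrA; apply: isIdealMl.
Qed.

Lemma sub_colon I f : isIdeal I -> subideal I (colon I f).
Proof. by move=> idI g Ig; apply: isIdealMr. Qed.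

Lemma sub_add_principal I f : subideal I (add_principal I f).
Proof. by move=> g Ig; exists g, 0; rewrite mul0r addr0. Qed.

Lemma add_principal_gen I f : isIdeal I -> add_principal I f f.
Proof. by move=> idI; exists 0, 1; rewrite add0r mul1r; split => //; apply: isIdeal0. Qed.

Lemma add_principal_min I J f :
  isIdeal J -> subideal I J -> J f -> subideal (add_principal I f) J.
Proof. by move=> idJ IJ Jf g [a [r [Ia ->]]]; apply: isIdealD; [|apply: IJ|apply: isIdealMl]. Qed.

Lemma prime_ideal P : primeIdeal P -> isIdeal P. Proof. by case=> -[]. Qed.

Lemma prime_prod P n (F : 'I_n -> R) :
  primeIdeal P -> P (\prod_i F i) -> exists i, P (F i).
Proof.
move=> prP; have [[idP P1] mulP] := prP.
suff: forall s : seq 'I_n, P (\prod_(i <- s) F i) -> exists i, P (F i) by apply.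
elim=> [|i s IHs]; first by rewrite big_nil.
by rewrite big_cons => /mulP[]; [exists i | exact: IHs].
Qed.

Lemma no_embedded_prime I : primeIdeal I -> no_embedded I.
Proof.
move=> prI P; split=> [[prP [f Pf]]|[prP [IP minP]]].
  have nIf : ~ I f by move=> If; apply: prP.1.2; apply/Pf; rewrite /colon mul1r.
  have PI : subideal P I by move=> g /Pf; case/prI.2.
  split=> //; split=> [g Ig|Q _ IQ _ g /PI]; last exact: IQ.
  by apply/Pf; apply: sub_colon => //; apply: prime_ideal.
split=> //; exists 1 => g; rewrite /colon mulr1; split; last exact: IP.
by apply: minP => //.
Qed.

Lemma assprime_colon I v P : assprime (colon I v) P -> assprime I P.
Proof.
by move=> [prP [f Pf]]; split=> //; exists (f * v) => g; rewrite Pf /colon mulrA.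
Qed.

(** Write [P] as [I : f]. If some multiple [g * f] with [g] outside [P] has the form [a + r * v]
    with [a] in [I], then [P] is also [I : (g * f)], which is [(I : v) : r]. If there is none, [P]
    is [(I + (v)) : f]. *)
Lemma assprime_split I v P :
  isIdeal I -> assprime I P -> assprime (colon I v) P \/ assprime (add_principal I v) P.
Proof.
move=> idI [prP [f Pf]].
have [[g [nPg [a [r [Ia gf]]]]]|no_g] :=
  classic (exists g, ~ P g /\ add_principal I v (g * f)).
  left; split=> //; exists r => h.
  have -> : P h <-> P (h * g).
    by split=> [Ph|/prP.2[] //]; apply: isIdealMr => //; apply: prime_ideal.
  rewrite Pf /colon -mulrA gf mulrDr mulrA.
  split=> [|]; last by apply: isIdealD => //; apply: isIdealMl.
  by move/isIdealB => /(_ (h * a) idI (isIdealMl _ idI Ia)); rewrite addrC addKr.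
right; split=> //; exists f => g; split=> [/Pf If|gf]; first exact: (@sub_add_principal I).
by apply: NNPP => nPg; apply: no_g; exists g.
Qed.

Lemma minprime_sub I J P : subideal I J -> subideal J P -> minprime I P -> minprime J P.
Proof.
move=> IJ JP [prP [_ minP]]; split=> //; split=> // Q prQ JQ.
by apply: minP => // f /IJ; apply: JQ.
Qed.

Lemma prime_colon_or_add I u Q : primeIdeal Q -> subideal I Q ->
  subideal (add_principal I u) Q \/ (~ Q u /\ subideal (colon I u) Q).
Proof.
move=> prQ IQ; have [Qu|nQu] := classic (Q u); last first.
  by right; split=> // f /IQ; case/prQ.2.
by left; apply: add_principal_min => //; apply: prime_ideal.
Qed.

(** Associated primes of [I] come from the two pieces, hence are minimal. A minimal prime containing
    [I : v] is associated to it, and so to [I]; the other minimal primes contain [I + (v)]. *)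
Lemma no_embedded_split I v : isIdeal I ->
    no_embedded (colon I v) -> no_embedded (add_principal I v) ->
    (forall P, minprime (colon I v) P -> minprime I P) ->
    (forall P, minprime (add_principal I v) P -> minprime I P) ->
  no_embedded I.
Proof.
move=> idI noC noA minC minA P; split.
  by move/(@assprime_split _ v) => /(_ idI) [/noC/minC|/noA/minA].
move=> mP; have [prP [IP _]] := mP.
have [CP|nCP] := classic (subideal (colon I v) P).
  by apply/(@assprime_colon _ v)/noC; apply: minprime_sub mP => //; apply: sub_colon.
have [g nCg] := not_all_ex_not _ _ nCP.
have [Igv nPg] := imply_to_and _ _ nCg.
have AP : subideal (add_principal I v) P.
  by have [|[_ /nCP]] := prime_colon_or_add v prP IP.
have /noA[_ [f Pf]] : minprime (add_principal I v) P.
  by apply: minprime_sub mP => //; apply: sub_add_principal.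
(* The factor [g] multiplies [v] into [I], so it carries [I + (v)] into [I]; being outside [P], it
   can be cancelled in the other direction. *)
split=> //; exists (g * f) => h; split=> [/Pf[a [r [Ia hf]]]|Ihgf].
  rewrite /colon mulrCA hf mulrDr mulrCA.
  by apply: isIdealD => //; apply: isIdealMl.
have /Pf : colon (add_principal I v) f (h * g).
  by apply: (@sub_add_principal I); rewrite -mulrA.
by case/prP.2.
Qed.

End IdealTheory.

(** * Images of ideals *)

Section Image.
Variables (R S : comNzRingType) (phi : {rmorphism R -> S}).
Implicit Types (I J P Q : R -> Prop) (f g u v : R).

Definition image_ideal J : S -> Prop := fun y => exists x, J x /\ phi x = y.

Inductive mul_ker J : R -> Prop :=
| mul_ker0 : mul_ker J 0
| mul_kerD a b f : J a -> phi b = 0 -> mul_ker J f -> mul_ker J (a * b + f).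

(* This is the vanishing of Tor_1(R / J, S): since J /\ ker phi = J * ker phi,
   short exact sequences ending in R / J stay exact after passing to S. *)
Definition ker_transversal J := forall f, J f -> phi f = 0 -> mul_ker J f.

Lemma mul_ker_add J f g : mul_ker J f -> mul_ker J g -> mul_ker J (f + g).
Proof.
move=> Jf Jg; elim: Jf => [|a b h Ja b0 _ IH]; first by rewrite add0r.
by rewrite -addrA; apply: mul_kerD.
Qed.

Lemma mul_ker_sub J f : isIdeal J -> mul_ker J f -> J f.
Proof.
move=> idJ; elim=> [|a b h Ja _ _ Jh]; first exact: isIdeal0.
by apply: isIdealD => //; apply: isIdealMr.
Qed.

(** The product of [J + (u)] with the kernel splits as [J ker phi + u ker phi]; all multiples of [u]
    are gathered into the single kernel element [y]. *)
Lemma mul_ker_add_principal J u f : mul_ker (add_principal J u) f ->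
  exists g y, mul_ker J g /\ phi y = 0 /\ f = g + u * y.
Proof.
elim=> [|_ b h [a [r [Ja ->]]] b0 _ [g [y [Jg [y0 ->]]]]].
  by exists 0, 0; rewrite rmorph0 mulr0 addr0; split=> //; constructor.
exists (a * b + g), (r * b + y); split; first by constructor.
rewrite rmorphD rmorphM b0 y0 mulr0 addr0; split=> //.
by rewrite mulrDl mulrDr addrACA -mulrA mulrCA.
Qed.

Lemma mul_ker_colon J u y : mul_ker (colon J u) y -> mul_ker J (u * y).
Proof.
elim=> [|a b h Ja b0 _ IH]; first by rewrite mulr0; constructor.
by rewrite mulrDr mulrA [u * a]mulrC; constructor.
Qed.

(** Transversality of [J + (u)] gives [f = g + u * y] with [g] in [J ker phi] and [y] in the kernel.
    Then [u * y] is in [J], so [y] lies in [(J : u) ker phi], and [u] carries this into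
    [J ker phi]. *)
Lemma transversal_split J u : isIdeal J ->
  ker_transversal (colon J u) -> ker_transversal (add_principal J u) -> ker_transversal J.
Proof.
move=> idJ trC trA f Jf f0.
have [g [y [Jg [y0 ef]]]] := mul_ker_add_principal (trA f (sub_add_principal u Jf) f0).
rewrite ef; apply: mul_ker_add => //; apply/mul_ker_colon/trC => //.
rewrite /colon mulrC -[u * y](addKr g) -ef addrC.
by apply: isIdealB => //; apply: mul_ker_sub.
Qed.

Hypothesis phi_surj : forall y, exists x, phi x = y.

Lemma image_is_ideal J : isIdeal J -> isIdeal (image_ideal J).
Proof.
move=> idJ; split; first by exists 0; rewrite rmorph0; split=> //; apply: isIdeal0.
split=> [_ _ [x [Jx <-]] [y [Jy <-]]|r _ [x [Jx <-]]].
  by exists (x + y); rewrite rmorphD; split=> //; apply: isIdealD.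
have [z <-] := phi_surj r.
by exists (z * x); rewrite rmorphM; split=> //; apply: isIdealMl.
Qed.

Lemma image_sub I J : subideal I J -> subideal (image_ideal I) (image_ideal J).
Proof. by move=> IJ _ [x [/IJ Jx <-]]; exists x. Qed.

Lemma image_add_principal J u :
  image_ideal (add_principal J u) = add_principal (image_ideal J) (phi u).
Proof.
apply: pred_ext => f; split=> [[_ [[a [r [Ja ->]]] <-]]|[_ [r [[x [Jx <-]] ->]]]].
  by exists (phi a), (phi r); rewrite rmorphD rmorphM; split=> //; exists a.
have [y <-] := phi_surj r.
by exists (x + y * u); rewrite rmorphD rmorphM; split=> //; exists x, y.
Qed.

Lemma image_colon J u : isIdeal J -> ker_transversal (add_principal J u) ->
  image_ideal (colon J u) = colon (image_ideal J) (phi u).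
Proof.
move=> idJ trA; apply: pred_ext => f; split=> [[x [Jx <-]]|].
  by exists (x * u); rewrite rmorphM.
have [g <-] := phi_surj f; case=> x [Jx ex].
(* This difference lies in [J + (u)] and in the kernel, so it equals [h + u * y] with [h] in
   [J ker phi]. The corrected lift [g + y] of [phi g] then satisfies [(g + y) * u = x - h], which is
   in [J]. *)
have Agx : add_principal J u (x - g * u).
  by exists x, (- g); rewrite mulNr.
have [|h [y [Jh [y0 eh]]]] := mul_ker_add_principal (trA _ Agx _).
  by rewrite rmorphB rmorphM ex subrr.
exists (g + y); split; last by rewrite rmorphD y0 addr0.
have -> : colon J u (g + y) = J (x - h).
  by rewrite /colon; congr J; rewrite -(subrK (g * u) x) eh mulrDl [y * u]mulrC addrAC
    [h + _]addrC addrK addrC.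
by apply: isIdealB => //; apply: mul_ker_sub.
Qed.

Lemma preim_ideal (I : S -> Prop) : isIdeal I -> isIdeal (fun x => I (phi x)).
Proof.
move=> idI; split; first by rewrite rmorph0; apply: isIdeal0.
split=> [a b|r a]; first by rewrite rmorphD; apply: isIdealD.
by rewrite rmorphM; apply: isIdealMl.
Qed.

Lemma preim_prime (Q : S -> Prop) : primeIdeal Q -> primeIdeal (fun x => Q (phi x)).
Proof.
move=> prQ; split; last by move=> a b; rewrite rmorphM; apply: prQ.2.
by split; [apply/preim_ideal/prime_ideal | rewrite rmorph1; apply: prQ.1.2].
Qed.

(** The preimage of [Q] is a prime over [J], so it contains a minimal prime [P'] of [J]. The image
    of [P'] is a prime between the image of [J] and [Q], and minimality of [Q] forces equality. *)
Lemma minprime_image J (Q : S -> Prop) :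
    (forall P, primeIdeal P -> subideal J P -> exists2 P', minprime J P' & subideal P' P) ->
    (forall P, minprime J P -> minprime (image_ideal J) (image_ideal P)) ->
  minprime (image_ideal J) Q -> exists2 P, minprime J P & Q = image_ideal P.
Proof.
move=> exP imP [prQ [JQ minQ]].
have [x Jx|P mP PQ] := exP _ (preim_prime prQ); first by apply: JQ; exists x.
have [prP' [JP' _]] := imP P mP.
have P'Q : subideal (image_ideal P) Q by move=> _ [x [/PQ Qx <-]].
by exists P => //; apply: pred_ext => f; split; [apply: minQ | apply: P'Q].
Qed.

End Image.
Arguments mul_ker {R S} phi J.
Arguments ker_transversal {R S} phi J.
Arguments image_ideal {R S} phi J.

(** * Minimal primes and images of k-clean ideals *)

Section KClean.
Variable K : fieldType.

Lemma kclean_facts k n (J : MP K n -> Prop) : kclean k J ->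
  [/\ monomial_ideal J, properIdeal J & no_embedded J].
Proof. by case=> // {}n {}J ? ? prJ; split=> //; apply: no_embedded_prime. Qed.

(** The counterpart for [J : u] of the cleaner condition on [J + (u)]: a minimal prime of [J : u] is
    associated to it, hence to [J], hence minimal over [J]. *)
Lemma kclean_minprime_colon k n (J : MP K n -> Prop) u P :
  no_embedded J -> kclean k (colon J u) -> minprime (colon J u) P -> minprime J P.
Proof. by move=> noJ /kclean_facts[_ _ noC] /noC/assprime_colon/noJ. Qed.

(** Induction along the decomposition replaces a Noetherian or Zorn argument: [Q] contains [J + (u)]
    or [J : u], and the minimal primes of both are minimal over [J]. *)
Lemma kclean_minprime_below k n (J Q : MP K n -> Prop) :
  kclean k J -> primeIdeal Q -> subideal J Q -> exists2 P, minprime J P & subideal P Q.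
Proof.
move=> kJ; elim: {n J} kJ Q => [n J _ _ prJ|n J u _ _ noJ clu _ kC IHC _ IHA] Q prQ JQ.
  by exists J => //; do 2!split=> //.
have [/IHA[] // P mP PQ|[_ /IHC[] // P mP PQ]] := prime_colon_or_add u prQ JQ.
  by exists P => //; apply: clu.2.2.2.
by exists P => //; apply: kclean_minprime_colon kC mP.
Qed.

(** The bound on supports is what lets the condition [supp_le u k.+1] pass from a cleaner to its
    image. *)
Definition monomial_map m n (phi : MP K m -> MP K n) := forall a, exists b,
  phi (mono K m a) = mono K n b /\
  (#|[set i : 'I_n | 0 < b i]| <= #|[set i : 'I_m | 0 < a i]|)%N.

Lemma monomial_ideal_image m n (phi : {rmorphism MP K m -> MP K n}) (J : MP K m -> Prop) :
    (forall y, exists x, phi x = y) -> monomial_map phi ->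
  monomial_ideal J -> monomial_ideal (image_ideal phi J).
Proof.
move=> phi_surj phi_mono [idJ genJ]; have idI := image_is_ideal phi_surj idJ.
split=> // f; split=> [[x [/genJ[s [Js ->]] <-]]|]; last first.
  by apply: idealGen_min => // g [].
exists [seq (phi p.1, phi p.2) | p <- s]; split.
  move=> _ /mapP[p /Js[Jp [a ea]] ->]; split; first by exists p.2.
  by have [b [eb _]] := phi_mono a; exists b; rewrite /= ea.
by rewrite big_map rmorph_sum; apply: eq_bigr => p _; rewrite rmorphM.
Qed.

Lemma kclean_image k m n (phi : {rmorphism MP K m -> MP K n}) (J : MP K m -> Prop) :
    (forall y, exists x, phi x = y) -> monomial_map phi -> kclean k J ->
    (forall P, minprime J P ->
      ker_transversal phi P /\ minprime (image_ideal phi J) (image_ideal phi P)) ->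
  ker_transversal phi J /\ kclean k (image_ideal phi J).
Proof.
move=> phi_surj phi_mono kJ.
elim: {m J} kJ phi phi_surj phi_mono => [m J moJ _ prJ|m J u moJ propJ noJ clu sup kC IHC kA IHA]
  phi phi_surj phi_mono good.
  (* A prime is its own minimal prime, so the hypothesis on minimal primes applies to [J] itself. *)
  have [|trJ [prI _]] := good J; first by split=> //; split=> // ?.
  by split=> //; apply: kclean_prime => //; [apply: monomial_ideal_image | case: prI].
have idJ := propJ.1.
have minC P := @kclean_minprime_colon k m J u P noJ kC.
have minA := clu.2.2.2.
have goodC P : minprime (colon J u) P -> ker_transversal phi P /\
    minprime (image_ideal phi (colon J u)) (image_ideal phi P).
  move=> mP; have [trP mI] := good P (minC P mP); split=> //.
  apply: minprime_sub mI; apply: image_sub; first exact: sub_colon.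
  exact: mP.2.1.
have goodA P : minprime (add_principal J u) P -> ker_transversal phi P /\
    minprime (image_ideal phi (add_principal J u)) (image_ideal phi P).
  move=> mP; have [trP mI] := good P (minA P mP); split=> //.
  apply: minprime_sub mI; apply: image_sub; first exact: sub_add_principal.
  exact: mP.2.1.
have [trC kIC] := IHC phi phi_surj phi_mono goodC.
have [trA kIA] := IHA phi phi_surj phi_mono goodA.
have eC := image_colon phi_surj idJ trA.
have eA := image_add_principal phi_surj J u.
(* Every minimal prime of the image is the image of a minimal prime of [J : u], hence of one of [J],
   whose image is minimal by hypothesis. *)
have minIC Q : minprime (image_ideal phi (colon J u)) Q -> minprime (image_ideal phi J) Q.
  case/minprime_image => [P|P /goodC[]//|P /minC mP ->]; last by case: (good P mP).
  exact: (kclean_minprime_below kC).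
have minIA Q : minprime (image_ideal phi (add_principal J u)) Q ->
    minprime (image_ideal phi J) Q.
  case/minprime_image => [P|P /goodA[]//|P /minA mP ->]; last by case: (good P mP).
  exact: (kclean_minprime_below kA).
have idI := image_is_ideal phi_surj idJ.
have [_ propC noC] := kclean_facts kIC; have [_ propA noA] := kclean_facts kIA.
rewrite {}eC {}eA in kIC kIA minIC minIA propC noC propA noA.
split; first exact: transversal_split trC trA.
apply: (kclean_step (u := phi u)) => //.
- exact: monomial_ideal_image.
- by split=> // /(sub_colon (phi u) idI)/propC.2.
- exact: no_embedded_split minIC minIA.
(* Properness of the two images makes [phi u] a legitimate cleaner: it is not 1 since the sum is
   proper, and not in the image of [J] since the colon is proper. *)
- split; first by apply/eqP => u1; apply: propA.2; rewrite u1; apply: add_principal_gen.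
  split; first by have [a [-> _]] := sup; have [b [-> _]] := phi_mono a; exists b.
  by split=> // Iu; apply: propC.2; rewrite /colon mul1r.
- have [a [-> le_a]] := sup; have [b [-> le_b]] := phi_mono a.
  by exists b; split=> //; apply: leq_trans le_a.
Qed.

End KClean.

(** * Substitution and coefficients *)

Section Polynomials.
Variable K : fieldType.

Fixpoint constMP n : {rmorphism K -> MP K n} :=
  match n with
  | 0 => (idfun : {rmorphism K -> K})
  | m.+1 => (polyC \o constMP m : {rmorphism K -> {poly MP K m}})
  end.

Fixpoint substMP n m (x : nat -> MP K n) : {rmorphism MP K m -> MP K n} :=
  match m with
  | 0 => constMP n
  | m'.+1 => horner_morph (fun y => mulrC (x m') (substMP m' x y))
  end.

Fixpoint coefMP n : MP K n -> (nat -> nat) -> K :=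
  match n with
  | 0 => fun f _ => f
  | m.+1 => fun (f : {poly MP K m}) b => coefMP f`_(b m) b
  end.

Lemma varn_last n : varn K n.+1 n = 'X.
Proof. by rewrite /= eqxx. Qed.

Lemma varn_lift n i : (i < n)%N -> varn K n.+1 i = (varn K n i)%:P.
Proof. by move=> lt_in; rewrite /= ltn_eqF. Qed.

(** Structural induction that treats all variables alike, hiding the nesting of univariate
    polynomial rings. *)
Lemma MP_ind n (P : MP K n -> Prop) :
    (forall c, P (constMP n c)) -> (forall f g, P f -> P g -> P (f + g)) ->
    (forall i f, (i < n)%N -> P f -> P (f * varn K n i)) ->
  forall f, P f.
Proof.
elim: n P => [|n IHn] P Pc PD PM; first exact: Pc.
elim/poly_ind => [|f c Pf]; first by rewrite -(rmorph0 (constMP n.+1)).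
apply: (PD); first by rewrite -varn_last; apply: (PM).
(* The constant coefficient is covered by the induction hypothesis for the predicate pulled back
   along [polyC]. *)
apply: (IHn (fun c => P c%:P)) => [d|g h Pg Ph|i g lt_in Pg]; first exact: Pc.
  by rewrite polyCD; apply: PD.
by rewrite polyCM -varn_lift //; apply: PM => //; apply: ltnW.
Qed.

Lemma substMP_const n m x c : substMP (n := n) m x (constMP m c) = constMP n c.
Proof. by elim: m => //= m IHm; rewrite /horner_morph map_polyC hornerC. Qed.

Lemma substMP_var n m x i : (i < m)%N -> substMP (n := n) m x (varn K m i) = x i.
Proof.
elim: m => // m IHm; rewrite ltnS leq_eqVlt => /predU1P[->|lt_im].
  by rewrite varn_last /= /horner_morph map_polyX hornerX.
by rewrite varn_lift //= /horner_morph map_polyC hornerC; apply: IHm.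
Qed.

(** Evaluation of all variables at 1 sends a variable to 1, which is nonzero in [K]. *)
Lemma varn_neq0 n i : (i < n)%N -> varn K n i != 0.
Proof.
move=> lt_in; apply/eqP => /(congr1 (substMP n (fun=> 1 : MP K 0))).
by rewrite substMP_var // rmorph0 => /eqP; rewrite oner_eq0.
Qed.

Lemma monoS n a : mono K n.+1 a = (mono K n a)%:P * 'X ^+ a n.
Proof.
rewrite /mono big_ord_recr varn_last; congr (_ * _).
rewrite rmorph_prod; apply: eq_bigr => i _.
by rewrite rmorphXn /= ltn_eqF.
Qed.

Lemma eq_mono n a b : (forall i, (i < n)%N -> a i = b i) -> mono K n a = mono K n b.
Proof. by move=> ab; apply: eq_bigr => i _; rewrite ab. Qed.

Lemma monoD n a b : mono K n (fun i => a i + b i)%N = mono K n a * mono K n b.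
Proof. by rewrite -big_split; apply: eq_bigr => i _; rewrite exprD. Qed.

Lemma mono_var n t : (t < n)%N -> mono K n (fun i => (i == t) : nat) = varn K n t.
Proof.
move=> lt_tn; rewrite /mono (bigD1 (Ordinal lt_tn)) //= eqxx big1 ?mulr1 // => i.
by rewrite -val_eqE => /= /negbTE->.
Qed.

Lemma coefMP0 n b : coefMP (0 : MP K n) b = 0.
Proof. by elim: n => //= n IHn; rewrite coef0. Qed.

Lemma coefMPD n (f g : MP K n) b : coefMP (f + g) b = coefMP f b + coefMP g b.
Proof. by elim: n f g => //= n IHn f g; rewrite coefD. Qed.

Lemma coefMP_sum n (X : Type) (s : seq X) (F : X -> MP K n) b :
  coefMP (\sum_(x <- s) F x) b = \sum_(x <- s) coefMP (F x) b.
Proof.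
by elim/big_rec2: _ => [|x f c _ <-]; [exact: coefMP0 | exact: coefMPD].
Qed.

Lemma coefMP_eq n (f : MP K n) b c :
  (forall i, (i < n)%N -> b i = c i) -> coefMP f b = coefMP f c.
Proof.
elim: n f => //= n IHn f bc; rewrite bc //; apply: IHn => i /ltnW; exact: bc.
Qed.

Lemma coefMP_neq0 n (f : MP K n) : f != 0 -> exists b, coefMP f b != 0.
Proof.
elim: n f => [|n IHn] f; first by exists (fun=> 0%N).
rewrite -lead_coef_eq0 => /IHn[b nz_b].
(* The exponent of the last variable is the degree in it; the others come from the leading
   coefficient. *)
exists (fun i => if i == n then (size (f : {poly MP K n})).-1 else b i) => /=.
rewrite eqxx; congr (_ != 0): nz_b.
by apply: coefMP_eq => i lt_in; rewrite ltn_eqF.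
Qed.

Lemma coefMP_const n c b i : (i < n)%N -> coefMP (constMP n c) b != 0 -> b i = 0%N.
Proof.
elim: n => // n IHn; rewrite ltnS leq_eqVlt /= coefC.
have [b0|_] := eqVneq (b n) 0%N; last by rewrite coefMP0 eqxx.
by case/predU1P => [-> //|]; apply: IHn.
Qed.

Lemma coefMP_mono n (f : MP K n) a b :
  coefMP (f * mono K n a) (fun i => b i + a i)%N = coefMP f b.
Proof.
elim: n f => [|n IHn] f; first by rewrite /mono big_ord0 /= mulr1.
by rewrite monoS mulrA /= coefMXn ltnNge leq_addl /= addnK coefMC IHn.
Qed.

Lemma coefMP_mono_le n (f : MP K n) a b :
  coefMP (f * mono K n a) b != 0 -> forall i, (i < n)%N -> (a i <= b i)%N.
Proof.
elim: n f => [|n IHn] f // nz i; move: nz.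
rewrite monoS mulrA /= coefMXn; case: leqP => [le_ab|]; last by rewrite coefMP0 eqxx.
by rewrite coefMC => /IHn le_n; rewrite ltnS leq_eqVlt => /predU1P[->|/le_n].
Qed.

Lemma coefMP_mono1 n a : coefMP (mono K n a) a != 0.
Proof.
rewrite -[mono K n a]mul1r (coefMP_mono 1 a (fun=> 0%N)).
rewrite -(rmorph1 (constMP n)); elim: n => [|n IHn] /=; first exact: oner_neq0.
by rewrite coefC.
Qed.

Lemma mono_dvd n (I : MP K n -> Prop) a c : isIdeal I ->
  (forall i, (i < n)%N -> (a i <= c i)%N) -> I (mono K n a) -> I (mono K n c).
Proof.
move=> idI le_ac Ia.
rewrite (eq_mono (b := fun i => (c i - a i + a i)%N)) => [|i /le_ac /subnK-> //].
by rewrite monoD; apply: isIdealMl.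
Qed.

End Polynomials.

(** * Primes generated by variables, and monomials in monomial ideals *)

Section MonomialIdeals.
Variable K : fieldType.

(** Exponents add up along the fibers of [q], so the support of the image lies in the image under
    [q] of the support. *)
Lemma substMP_monomial_map m n (q : nat -> nat) :
    (forall t, (t < m)%N -> (q t < n)%N) ->
  monomial_map (substMP m (fun t => varn K n (q t))).
Proof.
move=> q_lt a; pose h (t : 'I_m) := Ordinal (q_lt t (ltn_ord t)).
exists (fun i => \sum_(t < m | q t == i) a t)%N; split.
  rewrite rmorph_prod (partition_big h xpredT) //=; apply: eq_bigr => i _.
  rewrite -prodrXr; apply: eq_big => [t|t /eqP <-]; first by rewrite -val_eqE.
  by rewrite rmorphXn substMP_var.
have [sub_h] : [set i : 'I_n | 0 < \sum_(t < m | q t == i) a t]%N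
    \subset h @: [set t : 'I_m | 0 < a t]%N.
  apply/subsetP => i; rewrite inE lt0n sum_nat_eq0 negb_forall.
  case/existsP => t; rewrite negb_imply -lt0n => /andP[/eqP qt at0].
  by apply/imsetP; exists t; [rewrite inE | apply: val_inj; rewrite /= qt].
exact: leq_trans (subset_leq_card sub_h) (leq_imset_card _ _).
Qed.

Definition killMP n (B : pred nat) : {rmorphism MP K n -> MP K n} :=
  substMP n (fun i => if B i then 0 else varn K n i).

(** This is the ideal generated by the variables in [B]. Taken as the kernel of an endomorphism of a
    domain, it is prime at once; [killMP_decomp] recovers the generators. *)
Definition varIdeal n B : MP K n -> Prop := fun f => killMP n B f = 0.

Arguments killMP n B : clear implicits.
Arguments varIdeal n B f : clear implicits.

Lemma killMP_var n B i : (i < n)%N ->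
  killMP n B (varn K n i) = if B i then 0 else varn K n i.
Proof. by move=> lt_in; rewrite /killMP substMP_var. Qed.

Lemma varIdeal_var n B i : (i < n)%N -> varIdeal n B (varn K n i) <-> B i.
Proof.
move=> lt_in; rewrite /varIdeal killMP_var //; case: ifP => // _; split=> // /eqP.
by rewrite (negbTE (varn_neq0 K lt_in)).
Qed.

Lemma varIdeal_prime n B : primeIdeal (varIdeal n B).
Proof.
split; last by move=> a b; rewrite /varIdeal rmorphM => /eqP; rewrite mulf_eq0;
  case/orP => /eqP; [left | right].
split; last by rewrite /varIdeal rmorph1 => /eqP; rewrite oner_eq0.
split; first by rewrite /varIdeal rmorph0.
split=> [a b|r a]; first by rewrite /varIdeal rmorphD => -> ->; rewrite addr0.
by rewrite /varIdeal rmorphM => ->; rewrite mulr0.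
Qed.

Lemma killMP_decomp n B (f : MP K n) :
  exists r, f = killMP n B f + \sum_(i < n | B i) varn K n i * r i.
Proof.
elim/MP_ind: f => [c|f g [r ef] [s eg]|t f lt_tn [r ef]].
- exists (fun=> 0); rewrite /killMP substMP_const big1 ?addr0 // => i _.
  by rewrite mulr0.
- exists (fun i => r i + s i); rewrite {1}ef {1}eg rmorphD addrACA; congr (_ + _).
  by rewrite -big_split; apply: eq_bigr => i _; rewrite mulrDr.
rewrite rmorphM killMP_var //; case: ifPn => [Bt|_].
  exists (fun i => if i == Ordinal lt_tn then f else 0).
  rewrite mulr0 add0r (bigD1 (Ordinal lt_tn)) //= eqxx big1 ?addr0 1?mulrC // => i.
  by case/andP=> _ /negbTE->; rewrite mulr0.
exists (fun i => r i * varn K n t); rewrite {1}ef mulrDl; congr (_ + _).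
by rewrite mulr_suml; apply: eq_bigr => i _; rewrite mulrA.
Qed.

Lemma varIdeal_sub n (B : pred nat) (J : MP K n -> Prop) : isIdeal J ->
  (forall i, (i < n)%N -> B i -> J (varn K n i)) -> subideal (varIdeal n B) J.
Proof.
move=> idJ JB f f0; have [r ->] := killMP_decomp B f; rewrite f0 add0r.
by apply: ideal_sum => // i Bi; apply: isIdealMr => //; exact: (JB i (ltn_ord i)).
Qed.

Lemma coefMP_kill n (B : pred nat) (f : MP K n) b i :
  (i < n)%N -> B i -> coefMP (killMP n B f) b != 0 -> b i = 0%N.
Proof.
move=> lt_in Bi; elim/MP_ind: f b => [c|f g IHf IHg|t f lt_tn IHf] b.
- by rewrite /killMP substMP_const; apply: coefMP_const.
- rewrite rmorphD coefMPD; have [->|/IHf //] := eqVneq (coefMP (killMP n B f) b) 0.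
  by rewrite add0r; apply: IHg.
rewrite rmorphM killMP_var //; case: ifPn => [_|nBt]; first by rewrite mulr0 coefMP0 eqxx.
rewrite -mono_var // => nz; have le_b := coefMP_mono_le nz.
(* The truncated subtraction is exact below [n]: the nonzero coefficient of a multiple of the
   variable [t] forces [b t] to be positive. *)
pose d j := (b j - (j == t))%N.
have eb j : (j < n)%N -> b j = (d j + (j == t))%N by move=> /le_b /subnK.
have /IHf : coefMP (killMP n B f) d != 0.
  by move: nz; rewrite (coefMP_eq _ eb) coefMP_mono.
rewrite eb // => ->; case: eqP => // eit.
by rewrite -eit Bi in nBt.
Qed.

(** A monomial occurring in a combination of monomials of [I] occurs in one of the terms, hence is
    divisible by a monomial of [I]. *)
Lemma monomial_ideal_coef n (I : MP K n -> Prop) f b :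
  monomial_ideal I -> I f -> coefMP f b != 0 -> I (mono K n b).
Proof.
move=> [idI genI] /genI[s [Is ->]]; rewrite coefMP_sum => nz.
have /hasP[p /Is[Ip [a ea]] nzp] : has (fun p => coefMP (p.1 * p.2) b != 0) s.
  apply: contraR nz => /hasPn s0; rewrite big1_seq // => p /andP[_ /s0].
  by rewrite negbK => /eqP.
rewrite ea in Ip nzp.
by apply: mono_dvd Ip => //; apply: coefMP_mono_le nzp.
Qed.

(** Descent on the total degree: a monomial of [I] that is not a minimal generator has a proper
    divisor in [I], of smaller degree. *)
Lemma min_gen_below n (I : MP K n -> Prop) c : isIdeal I -> I (mono K n c) ->
  exists a, min_gen I (mono K n a) /\ forall i, (i < n)%N -> (a i <= c i)%N.
Proof.
move=> idI; have [d] := ubnP (\sum_(i < n) c i); elim: d c => // d IHd c lt_cd Ic.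
have [minc|] := classic (min_gen I (mono K n c)); first by exists c.
move=> nminc; apply: NNPP => no_a; apply: nminc; split; first by exists c.
split=> // _ [b ->] Ib [w ew].
have le_bc : forall i, (i < n)%N -> (b i <= c i)%N.
  apply: (@coefMP_mono_le K n w); rewrite mulrC -ew; exact: coefMP_mono1.
apply: NNPP => neq_bc; apply: no_a.
have [|a [mina le_ab]] := IHd b _ Ib; last first.
  by exists a; split=> // i lt_in; apply: leq_trans (le_ab i _) (le_bc i _).
apply: leq_trans (lt_cd : (_ <= d)%N);
  rewrite ltn_neqAle leq_sum ?andbT => [|i _]; last exact: le_bc.
apply/negP; have leif_bc (i : 'I_n) : true -> (b i <= c i ?= iff (b i == c i))%N.
  by move=> _; split=> //; apply: le_bc.
rewrite (leqif_sum leif_bc) => /forallP eq_bc; apply: neq_bc; apply: eq_mono => i lt_in.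
exact/eqP/(eq_bc (Ordinal lt_in)).
Qed.

End MonomialIdeals.
Arguments killMP K n B : clear implicits.
Arguments varIdeal K n B f : clear implicits.

(** * Polarization *)

Section Polarization.
Variables (K : fieldType) (n N : nat).
Hypothesis N_gt0 : (0 < N)%N.
Implicit Types (I : MP K n -> Prop) (P : MP K (n * N) -> Prop) (B : pred nat).

Lemma polar_index_lt i j : (i < n)%N -> (j < N)%N -> (i * N + j < n * N)%N.
Proof.
move=> lt_in lt_jN; apply: (@leq_trans (i.+1 * N)); last by rewrite leq_mul2r lt_in orbT.
by rewrite mulSn addnC ltn_add2r.
Qed.

Lemma polar_index_div i j : (j < N)%N -> ((i * N + j) %/ N)%N = i.
Proof. by move=> lt_jN; rewrite divnMDl // divn_small // addn0. Qed.

Lemma polar_index_mod i j : (j < N)%N -> ((i * N + j) %% N)%N = j.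
Proof. by move=> lt_jN; rewrite modnMDl modn_small. Qed.

Lemma index_div_lt t : (t < n * N)%N -> (t %/ N < n)%N.
Proof. by rewrite ltn_divLR. Qed.

Definition depolar : {rmorphism MP K (n * N) -> MP K n} :=
  substMP (n * N) (fun t => varn K n (t %/ N)).

Lemma depolar_var t : (t < n * N)%N -> depolar (varn K (n * N) t) = varn K n (t %/ N).
Proof. by move=> lt_t; rewrite /depolar substMP_var. Qed.

Lemma depolar_monomial_map : monomial_map depolar.
Proof. by apply: substMP_monomial_map; apply: index_div_lt. Qed.

(** For [c] with values below [N] this is a section of [depolar]; the free choice of [c] allows it
    to hit prescribed variables, one in each fiber. *)
Definition polar_section (c : nat -> nat) : {rmorphism MP K n -> MP K (n * N)} :=
  substMP n (fun i => polvar n N i (c i)).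

Lemma polar_sectionK c : (forall i, c i < N)%N -> cancel (polar_section c) depolar.
Proof.
move=> c_lt; elim/MP_ind => [a|f g ef eg|i f lt_in ef].
- by rewrite /polar_section /depolar !substMP_const.
- by rewrite !rmorphD ef eg.
by rewrite !rmorphM ef /polar_section substMP_var // depolar_var ?polar_index_lt //
  polar_index_div.
Qed.

Lemma depolar_surj y : exists x, depolar x = y.
Proof. by exists (polar_section (fun=> 0%N) y); apply: polar_sectionK. Qed.

Lemma depolar_polar_mono (a : nat -> nat) :
  (forall i, (i < n)%N -> (a i <= N)%N) -> depolar (polar_mono n N a) = mono K n a.
Proof.
move=> le_aN; rewrite rmorph_prod; apply: eq_bigr => i _; rewrite rmorph_prod.
rewrite (eq_bigr (fun=> varn K n i)) => [|j _]; first by rewrite prodr_const card_ord.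
have lt_jN : (j < N)%N := leq_trans (ltn_ord j) (le_aN i (ltn_ord i)).
by rewrite depolar_var ?polar_index_lt // polar_index_div.
Qed.

Lemma depolar_polarization I : monomial_ideal I -> polar_bound N I ->
  image_ideal depolar (polarization N I) = I.
Proof.
move=> [idI genI] bI; have idP := idealGen_ideal (fun g : MP K (n * N) =>
  exists a, min_gen I (mono K n a) /\ g = polar_mono n N a).
apply: pred_ext => f; split=> [[x [Px <-]]|/genI].
  apply: (idealGen_min (preim_ideal depolar idI) _ Px) => _ [a [mina ->]].
  by rewrite depolar_polar_mono; [case: mina => _ [] | apply: bI].
have idim := image_is_ideal (@depolar_surj) idP.
apply: idealGen_min => // g [Ig [c ec]]; rewrite ec in Ig *.
have [a [mina le_ac]] := min_gen_below idI Ig.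
apply: mono_dvd le_ac _ => //; exists (polar_mono n N a); split.
  by apply: idealGen_gen; exists a.
by rewrite depolar_polar_mono //; apply: bI.
Qed.

(** * Minimal primes of the polarization and their images *)

Definition fiber_choice B (c : nat -> nat) : pred nat :=
  fun t => (B (t %/ N) && (t %% N == c (t %/ N)))%N.

Lemma fiber_choice_index B c i j : (j < N)%N ->
  fiber_choice B c (i * N + j) = B i && (j == c i).
Proof. by move=> lt_jN; rewrite /fiber_choice polar_index_div // polar_index_mod. Qed.

(** The inequality [c i < a i] says exactly that the chosen variable of the fiber [i] divides the
    polarization of [mono K n a]. *)
Lemma polarization_sub_fiber_choice I B c : polar_bound N I ->
    (forall a, min_gen I (mono K n a) -> exists i, [/\ (i < n)%N, B i & (c i < a i)%N]) ->
  subideal (polarization N I) (varIdeal K (n * N) (fiber_choice B c)).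
Proof.
move=> bI hit; have prA := @varIdeal_prime K (n * N) (fiber_choice B c).
apply: idealGen_min => [|_ [a [mina ->]]]; first exact: prime_ideal.
have [i [lt_in Bi lt_ca]] := hit a mina.
have lt_cN : (c i < N)%N by apply: leq_trans lt_ca (bI a mina i lt_in).
rewrite /varIdeal /polar_mono (bigD1 (Ordinal lt_in)) //= (bigD1 (Ordinal lt_ca)) //=.
rewrite !rmorphM killMP_var ?polar_index_lt // fiber_choice_index // Bi eqxx.
by rewrite !mul0r.
Qed.

Lemma polarization_minprime I P : polar_bound N I -> minprime (polarization N I) P ->
  exists B c,
  [/\ forall i, B i -> (c i < N)%N, P = varIdeal K (n * N) (fiber_choice B c),
      forall a, min_gen I (mono K n a) -> exists i, [/\ (i < n)%N, B i & (c i < a i)%N] &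
      forall i, (i < n)%N -> B i -> exists a, min_gen I (mono K n a) /\
        forall i', (i' < n)%N -> B i' -> i' != i -> (a i' <= c i')%N].
Proof.
move=> bI [prP [JP minP]]; have idP := prime_ideal prP.
(* Membership in [P] is made boolean so that [has] and [find] can locate the first variable of each
   fiber in [P]. *)
pose A t : bool := if excluded_middle_informative (P (varn K (n * N) t)) then true else false.
have AP t : A t <-> P (varn K (n * N) t).
  by rewrite /A; case: excluded_middle_informative.
pose B i := has (fun j => A (i * N + j)%N) (iota 0 N).
pose c i := find (fun j => A (i * N + j)%N) (iota 0 N).
have c_lt i : B i -> (c i < N)%N by rewrite /B has_find size_iota.
have c_A i : B i -> A (i * N + c i)%N.
  by move=> Bi; have := nth_find 0%N Bi; rewrite nth_iota ?c_lt.
have c_min i j : (j < N)%N -> A (i * N + j)%N -> B i /\ (c i <= j)%N.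
  move=> lt_jN Aij; split; first by apply/hasP; exists j => //; rewrite mem_iota.
  rewrite leqNgt; apply/negP => lt_jc.
  by have := before_find 0%N lt_jc; rewrite nth_iota // add0n Aij.
have hit a : min_gen I (mono K n a) -> exists i, [/\ (i < n)%N, B i & (c i < a i)%N].
  move=> mina; have /JP/(prime_prod prP)[i /(prime_prod prP)[j /AP Aij]] :
    polarization N I (polar_mono n N a) by apply: idealGen_gen; exists a.
  have lt_jN : (j < N)%N := leq_trans (ltn_ord j) (bI a mina i (ltn_ord i)).
  have [Bi le_cj] := c_min i j lt_jN Aij.
  by exists i; split=> //; apply: leq_ltn_trans le_cj (ltn_ord j).
exists B, c; split=> //.
  have AsubP B' : (forall i, B' i -> B i) ->
      subideal (varIdeal K (n * N) (fiber_choice B' c)) P.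
    move=> B'B; apply: varIdeal_sub => // t lt_t /andP[/B'B Bt /eqP ct].
    by apply/AP; rewrite (divn_eq t N) ct; apply: c_A.
  apply: pred_ext => f; split; last exact: AsubP.
  by apply: minP (AsubP B _) f => //; [apply: varIdeal_prime |
    apply: polarization_sub_fiber_choice].
move=> i lt_in Bi; apply: NNPP => no_a.
(* If every generator were hit outside the fiber [i], then dropping this fiber would still give a
   prime over the polarization; it lies inside [P] but misses the chosen variable of the fiber
   [i]. *)
pose B' : pred nat := fun i' => B i' && (i' != i).
have hit' a : min_gen I (mono K n a) -> exists i, [/\ (i < n)%N, B' i & (c i < a i)%N].
  move=> mina; apply: NNPP => no_i; apply: no_a; exists a; split=> // i' lt_i' Bi' neq_i'.
  by rewrite leqNgt; apply/negP => lt_ca; apply: no_i; exists i'; rewrite /B' Bi' neq_i'.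
have /(_ (polvar n N i (c i))) : subideal P (varIdeal K (n * N) (fiber_choice B' c)).
  apply: minP; first exact: varIdeal_prime.
    exact: polarization_sub_fiber_choice.
  apply: varIdeal_sub => // t lt_t /andP[/andP[Bt _] /eqP ct].
  by apply/AP; rewrite (divn_eq t N) ct; apply: c_A.
rewrite varIdeal_var ?polar_index_lt ?c_lt // fiber_choice_index ?c_lt // /B' eqxx andbF.
by move=> /(_ (proj1 (AP _) (c_A i Bi))).
Qed.

(** The composite [e] of [depolar] with a suitable section fixes the generators [x_t] of the prime.
    For [f = sum x_t r_t] in the kernel, [e f = 0] gives [f = sum x_t (r_t - e r_t)], and each
    [r_t - e r_t] is in the kernel. *)
Lemma fiber_choice_transversal B c : (forall i, B i -> (c i < N)%N) ->
  ker_transversal depolar (varIdeal K (n * N) (fiber_choice B c)).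
Proof.
(* Outside [B] the value of [c] may exceed the range; 0 is a valid index there because [N] is
   positive. *)
move=> c_lt f f0 df0; pose c0 i := if B i then c i else 0%N.
have c0_lt i : (c0 i < N)%N by rewrite /c0; case: ifP => // /c_lt.
pose e g := polar_section c0 (depolar g).
have e_var t : (t < n * N)%N -> fiber_choice B c t ->
    e (varn K (n * N) t) = varn K (n * N) t.
  move=> lt_t /andP[Bt /eqP ct]; rewrite /e depolar_var // /polar_section.
  by rewrite substMP_var ?index_div_lt // /polvar /c0 Bt -ct -divn_eq.
have [r] := killMP_decomp (fiber_choice B c) f; rewrite f0 add0r => ef.
have : \sum_(t < n * N | fiber_choice B c t) varn K (n * N) t * e (r t) = 0.
  transitivity (e f); last by rewrite /e df0 rmorph0.
  rewrite {1}ef /e !rmorph_sum; apply: eq_bigr => t Bt.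
  by rewrite -{1}e_var // /e !rmorphM.
move=> e0; rewrite -[f]subr0 -e0 ef -sumrB.
apply: big_ind => [||t Bt]; [exact: mul_ker0 | exact: mul_ker_add |].
rewrite -mulrBr -[_ * _]addr0; constructor; last exact: mul_ker0.
  by apply/varIdeal_var.
by rewrite rmorphB /e polar_sectionK // subrr.
Qed.

Lemma image_fiber_choice B c : (forall i, B i -> (c i < N)%N) ->
  image_ideal depolar (varIdeal K (n * N) (fiber_choice B c)) = varIdeal K n B.
Proof.
move=> c_lt; have prA := @varIdeal_prime K (n * N) (fiber_choice B c).
have idA := prime_ideal prA.
have prB := @varIdeal_prime K n B; have idB := prime_ideal prB.
apply: pred_ext => g; split=> [[f [Pf <-]]|].
  apply: (varIdeal_sub (preim_ideal depolar idB) _ Pf) => t lt_t /andP[Bt _].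
  by rewrite depolar_var // varIdeal_var // index_div_lt.
apply: varIdeal_sub; first exact: (image_is_ideal (@depolar_surj) idA).
move=> i lt_in Bi; exists (polvar n N i (c i)); split.
  apply/varIdeal_var; first by apply: polar_index_lt => //; apply: c_lt.
  by rewrite fiber_choice_index ?c_lt // Bi eqxx.
by rewrite depolar_var ?polar_index_lt ?c_lt // polar_index_div ?c_lt.
Qed.

(** The prime is exhibited as [I : x^d] for a standard monomial [x^d] that leaves the standard ones
    when multiplied by any variable in [B]. It is therefore associated to [I], hence minimal. *)
Lemma varIdeal_minprime I B c : monomial_ideal I -> no_embedded I -> polar_bound N I ->
    (forall a, min_gen I (mono K n a) -> exists i, [/\ (i < n)%N, B i & (c i < a i)%N]) ->
    (forall i, (i < n)%N -> B i -> exists a, min_gen I (mono K n a) /\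
      forall i', (i' < n)%N -> B i' -> i' != i -> (a i' <= c i')%N) ->
  minprime I (varIdeal K n B).
Proof.
move=> moI noI bI hit thin; have idI := moI.1.
(* The exponent [N] outside [B] dominates every minimal generator there, so only the exponents in
   [B] decide whether a multiple of [x^d] lies in [I]. *)
pose standard (d : nat -> nat) := [/\ forall i, (i < n)%N -> B i -> (c i <= d i)%N,
  forall i, (i < n)%N -> ~~ B i -> d i = N & ~ I (mono K n d)].
have [d [[le_cd d_N nId] d_max]] : exists d, standard d /\
    forall i, (i < n)%N -> B i -> I (mono K n d * varn K n i).
  apply: NNPP => no_max.
  (* Without a maximal [d], standard exponents of arbitrarily large degree arise, starting from [c]
     on [B] and [N] elsewhere. *)
  have unbounded s : exists d, standard d /\ (s <= \sum_(i < n) d i)%N.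
    elim: s => [|s [d [std le_sd]]].
      exists (fun i => if B i then c i else N); split=> //.
      split=> [i _ -> //|i _ /negbTE-> //|/(min_gen_below idI)[a [mina le_a]]].
      have [i [lt_in Bi]] := hit a mina; have := le_a i lt_in.
      by rewrite Bi leqNgt => /negbTE->.
    have [i [lt_in [Bi nIdi]]] : exists i, (i < n)%N /\ B i /\ ~ I (mono K n d * varn K n i).
      apply: NNPP => no_i; apply: no_max; exists d; split=> // i lt_in Bi.
      by apply: NNPP => nIdi; apply: no_i; exists i.
    have [le_cd d_N nId] := std.
    exists (fun j => d j + (j == i))%N; split.
      split=> [j lt_jn Bj|j lt_jn nBj|]; first by apply/leq_trans/leq_addr/le_cd.
        by rewrite d_N //; case: eqP nBj => [->|_ _]; rewrite ?Bi ?addn0.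
      by rewrite monoD mono_var.
    rewrite big_split /= [X in (_ + X)%N](bigD1 (Ordinal lt_in)) //= eqxx add1n addnS ltnS.
    by apply: leq_trans (leq_addr _ _).
  have [d [[le_cd d_N nId] lt_d]] := unbounded (n * N).+1.
  suff : (\sum_(i < n) d i <= n * N)%N by rewrite leqNgt lt_d.
  rewrite -[n in (n * N)%N]card_ord -sum_nat_const; apply: leq_sum => i _.
  (* An exponent above [N] at [i] in [B] is impossible: the generator that [thin] provides for [i]
     is bounded by [c] on the rest of [B] and by [N] elsewhere, so it would divide [x^d]. *)
  have [Bi|/d_N-> //] := boolP (B i); rewrite leqNgt; apply/negP => lt_Nd.
  have [a [mina le_ac]] := thin i (ltn_ord i) Bi; apply: nId.
  apply: mono_dvd (mina.2.1) => // j lt_jn.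
  have [->|neq_ji] := eqVneq j i; first exact/ltnW/(leq_ltn_trans (bI a mina i _)).
  have [Bj|/d_N-> //] := boolP (B j); last exact: bI.
  exact: leq_trans (le_ac j lt_jn Bj neq_ji) (le_cd j lt_jn Bj).
have varI : subideal (varIdeal K n B) (colon I (mono K n d)).
  apply: varIdeal_sub; first exact: colon_ideal.
  by move=> i lt_in Bi; rewrite /colon mulrC; apply: d_max.
apply/noI; split; first exact: varIdeal_prime.
exists (mono K n d) => g; split; first exact: varI.
(* A surviving monomial [x^b] of [g] involves no variable in [B], yet [x^(b + d)] is in [I]. A
   minimal generator dividing it then already divides [x^d], a contradiction. *)
move=> Ig; apply: NNPP => /eqP /coefMP_neq0[b nz_b].
have [r eg] := killMP_decomp B g.
have : I (killMP K n B g * mono K n d).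
  rewrite -[killMP K n B g](addrK (\sum_(i < n | B i) varn K n i * r i)) -eg mulrBl.
  apply: isIdealB => //; apply: varI; apply: ideal_sum => [|i Bi].
    exact/prime_ideal/varIdeal_prime.
  by apply: isIdealMr; [apply/prime_ideal/varIdeal_prime | apply/varIdeal_var].
move/(monomial_ideal_coef moI) => /(_ (fun i => b i + d i)%N).
rewrite coefMP_mono => /(_ nz_b) /(min_gen_below idI)[a [mina le_a]].
apply: nId; apply: mono_dvd (mina.2.1) => // i lt_in.
have [Bi|/(d_N _ lt_in)->] := boolP (B i); last exact: bI.
by have := le_a i lt_in; rewrite (coefMP_kill lt_in Bi nz_b).
Qed.

End Polarization.

Theorem theorem3p3 (K : fieldType) (n N k : nat) (I : MP K n -> Prop) :
  monomial_ideal I -> properIdeal I -> no_embedded I ->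
  polar_bound N I ->
  kclean k (polarization N I) ->
  kclean k I.
Proof.
move=> moI propI noI bI kP; have idI := propI.1.
(* With [N = 0] the only possible minimal generator is 1, which a proper ideal excludes; so [I] is
   zero, a prime ideal. *)
have [N0|N_gt0] := posnP N.
  have nImono c : ~ I (mono K n c).
    move=> /(min_gen_below idI)[a [mina _]]; apply: propI.2.
    have [_ [Ia _]] := mina; rewrite /mono big1 in Ia => // i _.
    by have := bI a mina i (ltn_ord i); rewrite N0 leqn0 => /eqP->; rewrite expr0.
  have I0 f : I f -> f = 0.
    move=> /moI.2[[|p s] [Is ->]]; first by rewrite big_nil.
    have [Ip [c ec]] := Is p (mem_head p s).
    by rewrite ec in Ip; case: (nImono c).
  apply: kclean_prime => //; split=> // a b /I0/eqP; rewrite mulf_eq0.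
  by case/orP=> /eqP->; [left | right]; apply: isIdeal0.
have eI := depolar_polarization N_gt0 moI bI.
rewrite -[I in kclean k I]eI.
apply: (kclean_image (@depolar_surj K n N N_gt0) (@depolar_monomial_map K n N N_gt0) kP _).2.
move=> P /(polarization_minprime N_gt0 bI)[B [c [c_lt -> hit thin]]].
split; first exact: fiber_choice_transversal.
by rewrite eI image_fiber_choice //; apply: (varIdeal_minprime moI noI bI hit thin).
Qed.
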